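(* Let $M$ be a compact Riemannian manifold of dimension $d\ge 1$, let $f:M\to M$ be a $C^1$ map, and let $\Lambda\subseteq M$ be a compact invariant set which contains no critical points of $f$. Suppose that the tangent bundle over $\Lambda$ admits a continuous decomposition $T_\Lambda M=E^1_\Lambda\oplus E^2_\Lambda$ into $Df$-invariant subbundles, and that every $\lambda'\in\mathcal L^1(f)$ satisfies $\lambda'>0$. Then $\Lambda$ is uniformly expanding in the direction of $E^1$, i.e. there exist constants $C,\lambda>0$ such that $$\|Df^n_x(v)\|\ge Ce^{\lambda n}\|v\|$$ for all $x\in\Lambda$, all $v\in E^1_x$ and all $n\ge1$.
   Context: Invariant means $f(\Lambda)\subseteq\Lambda$. A point $x$ is a critical point of $f$ if $\det Df_x=0$. The decomposition is $Df$-invariant if $Df_x(E^i_x)\subseteq E^i_{f(x)}$ for all $x\in\Lambda$ and $i=1,2$; continuous means that the subspaces $E^1_x,E^2_x$ depend continuously on $x\in\Lambda$. No hyperbolicity is assumed in the direction of $E^2$, and $E^2_\Lambda$ may be trivial. $\mathcal L^1(f)$ denotes the set of Lyapunov exponents of $f$ on $\Lambda$ in the direction of $E^1$: the set of all $\lambda\in\mathbb R$ for which there exist a point $x\in\Lambda$ and a nonzero vector $v\in E^1_x$ such that the limit $\lim_{n\to\infty}\frac1n\log\|Df^n_x(v)\|$ exists and equals $\lambda$. *)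

(* Defs.v *)
From mathcomp Require Import all_boot all_order all_algebra.
From mathcomp Require Import all_classical all_reals all_analysis.

Set Implicit Arguments.
Unset Strict Implicit.
Unset Printing Implicit Defensive.

Import Order.TTheory GRing.Theory Num.Theory numFieldNormedType.Exports.
Local Open Scope classical_set_scope.
Local Open Scope ring_scope.

(* Meant for U open and V finite-dimensional: differentiability at each point
   of U then depends only on h restricted to U, and asking all the directional
   derivatives to be of class C^k amounts to asking it of the differential. *)
Fixpoint Ck (R : realType) (V W : normedModType R) (k : nat) (U : set V)
    (h : V -> W) : Prop :=
  match k with
  | 0 => forall x, U x -> {for x, continuous h}
  | k'.+1 => (forall x, U x -> differentiable h x) /\
             (forall v : V, Ck k' U ('D_v h))
  end.

Definition smooth (R : realType) (V W : normedModType R) (U : set V)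
    (h : V -> W) : Prop :=
  forall k, Ck k U h.

(* A homeomorphism from an open set of M to an open set of R^d. The functions
   fwd and bwd are total; their values outside dom and fwd @` dom are junk. *)
Record chart (R : realType) (M : topologicalType) (d : nat) := Chart {
  dom : set M;
  fwd : M -> 'rV[R]_d;
  bwd : 'rV[R]_d -> M;
  open_dom : open dom;
  open_cod : open (fwd @` dom);
  fwdK : forall x, dom x -> bwd (fwd x) = x;
  fwd_continuous : forall x, dom x -> {for x, continuous fwd};
  bwd_continuous : forall y, (fwd @` dom) y -> {for y, continuous bwd}
}.

Definition cod (R : realType) (M : topologicalType) (d : nat)
    (c : chart R M d) : set 'rV[R]_d :=
  fwd c @` dom c.

(* C^oo manifolds of dimension d, without boundary. Besides its atlas, a
   manifold carries the choice of a preferred chart around each point, which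
   serves to represent tangent vectors. *)
Record manifold (R : realType) (d : nat) := Manifold {
  carrier :> topologicalType;
  atlas : set (chart R carrier d);
  chart_at : carrier -> chart R carrier d;
  manifold_hausdorff : hausdorff_space carrier;
  manifold_second_countable : @second_countable carrier;
  chart_at_atlas : forall x, atlas (chart_at x);
  dom_chart_at : forall x, dom (chart_at x) x;
  smooth_transition : forall c c', atlas c -> atlas c' ->
    smooth [set y | cod c y /\ dom c' (bwd c y)] (fwd c' \o bwd c)
}.

(* T_x M, a tangent vector being given by its coordinates in chart_at x. *)
Definition tangent (R : realType) (d : nat) (M : manifold R d) (x : M) :=
  'rV[R]_d.

(* The coordinates in the chart c of a tangent vector at x. *)
Definition to_chart (R : realType) (d : nat) (M : manifold R d)
    (c : chart R M d) (x : M) (v : tangent x) : 'rV[R]_d :=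
  'd (fwd c \o bwd (chart_at x)) (fwd (chart_at x) x) v.

(* The tangent vector at x with coordinates u in the chart c. *)
Definition of_chart (R : realType) (d : nat) (M : manifold R d)
    (c : chart R M d) (x : M) (u : 'rV[R]_d) : tangent x :=
  'd (fwd (chart_at x) \o bwd c) (fwd c x) u.

Record riemannian_metric (R : realType) (d : nat) (M : manifold R d) :=
  RiemannianMetric {
  inner :> forall x : M, tangent x -> tangent x -> R;
  inner_linear : forall (x : M) (a : R) (u v w : tangent x),
    inner (a *: u + v) w = a * inner u w + inner v w;
  inner_sym : forall (x : M) (u v : tangent x), inner u v = inner v u;
  inner_gt0 : forall (x : M) (v : tangent x), v != 0 -> 0 < inner v v;
  inner_smooth : forall c, atlas c -> forall u v : 'rV[R]_d,
    @smooth R 'rV[R]_d R^o (cod c)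
      (fun y => inner (of_chart c (bwd c y) u) (of_chart c (bwd c y) v))
}.

Definition riemannian_norm (R : realType) (d : nat) (M : manifold R d)
    (g : riemannian_metric M) (x : M) (v : tangent x) : R :=
  Num.sqrt (g x v v).

Definition C1_map (R : realType) (d : nat) (M : manifold R d) (f : M -> M) :
    Prop :=
  continuous f /\
  forall c c', atlas c -> atlas c' ->
    Ck 1 [set y | cod c y /\ dom c' (f (bwd c y))] (fwd c' \o f \o bwd c).

Definition local_rep (R : realType) (d : nat) (M : manifold R d) (f : M -> M)
    (x : M) : 'rV[R]_d -> 'rV[R]_d :=
  fwd (chart_at (f x)) \o f \o bwd (chart_at x).

Definition tangent_map (R : realType) (d : nat) (M : manifold R d)
    (f : M -> M) (x : M) (v : tangent x) : tangent (f x) :=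
  'd (local_rep f x) (fwd (chart_at x) x) v.

Definition critical_point (R : realType) (d : nat) (M : manifold R d)
    (f : M -> M) (x : M) : Prop :=
  \det (jacobian (local_rep f x) (fwd (chart_at x) x)) = 0.

(* Continuity of x |-> E x on L (values outside L are irrelevant): near each
   point of L, E has a basis made of vector fields that are continuous on L.
   The rank is locally constant on L but need not be constant. *)
Definition continuous_subbundle (R : realType) (d : nat) (M : manifold R d)
    (L : set M) (E : forall x : M, {vspace tangent x}) : Prop :=
  forall x0, L x0 ->
  exists (U : set M) (k : nat) (e : 'I_k -> forall x : M, tangent x),
    [/\ open_nbhs x0 U, U `<=` dom (chart_at x0),
        forall x, L x -> U x -> basis_of (E x) [seq e j x | j : 'I_k] &
        forall j, {within L `&` U,
                    continuous (fun x => to_chart (chart_at x0) (e j x))}].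

Definition continuous_splitting (R : realType) (d : nat) (M : manifold R d)
    (L : set M) (E1 E2 : forall x : M, {vspace tangent x}) : Prop :=
  [/\ continuous_subbundle L E1, continuous_subbundle L E2 &
      forall x, L x ->
        (E1 x + E2 x)%VS = fullv /\ (E1 x :&: E2 x)%VS = 0%VS].

Definition tangent_invariant (R : realType) (d : nat) (M : manifold R d)
    (f : M -> M) (L : set M) (E : forall x : M, {vspace tangent x}) : Prop :=
  forall x, L x -> forall v : tangent x,
    v \in E x -> tangent_map f v \in E (f x).

Definition lyapunov_exponents (R : realType) (d : nat) (M : manifold R d)
    (g : riemannian_metric M) (f : M -> M) (L : set M)
    (E : forall x : M, {vspace tangent x}) : set R :=
  [set l : R | exists (x : M) (v : tangent x),
    [/\ L x, v \in E x, v != 0 &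
        (fun n : nat => n%:R^-1 * ln (riemannian_norm g (tangent_map (iter n f) v)))
          @ \oo --> l]].

Definition uniformly_expanding (R : realType) (d : nat) (M : manifold R d)
    (g : riemannian_metric M) (f : M -> M) (L : set M)
    (E : forall x : M, {vspace tangent x}) : Prop :=
  exists C l : R, [/\ 0 < C, 0 < l &
    forall (x : M) (v : tangent x) (n : nat),
      L x -> v \in E x -> (1 <= n)%N ->
      riemannian_norm g (tangent_map (iter n f) v) >= C * expR (l * n%:R) * riemannian_norm g v].

(* Main.v *)
Require Import Defs.
From mathcomp Require Import all_boot all_order all_algebra.
From mathcomp Require Import all_classical all_reals all_analysis.
From mathcomp Require Import lra.

Import Order.TTheory GRing.Theory Num.Theory numFieldNormedType.Exports.

Set Implicit Arguments.
Unset Strict Implicit.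
Unset Printing Implicit Defensive.

Local Open Scope classical_set_scope.
Local Open Scope ring_scope.

(** Let [T] be the map induced by [f] on the nonzero vectors of [E1] over [L],
    and let [growth n p] be [ln |T^n p| - ln |p|], an additive cocycle over [T].
    Call [l] a uniform lower rate if [growth n p >= l * n - C] for some [C] and
    all [n] and [p]. Uniform expansion says exactly that there is a positive
    uniform lower rate, so let [m] be the supremum of these rates; it is to be
    shown that [m > 0].

    The point is that [m] is itself a Lyapunov exponent, attained at a single
    vector [p] (lemma [minimal_growth_rate_attained]). Indeed there is a [p]
    with [growth k p <= m * k] for all [k >= 1]. Otherwise every [p] has some
    [k] with [growth k p > m * k]; by compactness of the sphere bundle [k] can
    be taken bounded and [m] replaced by [m + e] for some fixed [e > 0]; cutting
    every orbit into pieces on which the growth is at least [m + e] per step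
    makes [m + e] a uniform lower rate, which contradicts the choice of [m].
    For this [p], the quotients [growth n p / n] are at most [m], and their
    lower limit is at least every uniform lower rate: they converge to [m].
    Hence [m] is an exponent, and [m > 0] by hypothesis.

    What remains is to justify compactness. The total space of the tangent
    bundle is the set of pairs [(x, v)] with [v] read in the preferred chart at
    [x]; as that chart may jump with [x], the neighbourhoods of [(x0, v0)] are
    pulled back from the chart at [x0] (definition [tangent_nbhs]). For them the
    induced map and the Riemannian norm are continuous ([tangent_lift_cvg],
    [riemannian_norm_cvg]), and local statements about nonzero vectors of the
    subbundle that are insensitive to scaling hold uniformly
    ([uniform_on_nonzero_vectors]). *)

(** * Minimal growth rates along the orbits of a map *)

Section MinimalGrowth.
Context {R : realType} {X : Type}.
Variables (T : X -> X) (Phi : X -> R) (D : set X).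

Definition growth (n : nat) (p : X) : R := Phi (iter n T p) - Phi p.

Lemma growthD j k p : growth (j + k) p = growth k p + growth j (iter k T p).
Proof. by rewrite /growth iterD [RHS]addrC addrA subrK. Qed.

Definition uniform_lower_rates : set R :=
  [set l | exists C, forall p n, D p -> l * n%:R - C <= growth n p].

Hypothesis T_stable : forall p, D p -> D (T p).

Lemma iter_stable n p : D p -> D (iter n T p).
Proof. by move=> Dp; elim: n => //= n; exact: T_stable. Qed.

Variable B : R.
Hypothesis growth1_le : forall p, D p -> `|growth 1 p| <= B.

Lemma growth_le n p : D p -> `|growth n p| <= B * n%:R.
Proof.
move=> Dp; elim: n => [|n IHn]; first by rewrite /growth /= subrr normr0 mulr0.
rewrite -add1n growthD (le_trans (ler_normD _ _))// natrD mulrDr addrC mulr1.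
by rewrite lerD// growth1_le//; exact: iter_stable.
Qed.

(** Cut the orbit of [p] at successive return times; every piece but the last
    grows at rate at least [l], and the last one, shorter than [N], costs at
    most the constant [(B + |l|) * N]. *)
Lemma uniform_lower_rate_of_returns (l : R) (N : nat) :
  (forall p, D p -> exists k,
     [/\ (0 < k)%N, (k <= N)%N & l * k%:R <= growth k p]) ->
  uniform_lower_rates l.
Proof.
move=> ret; exists ((B + `|l|) * N%:R) => p n; move: {2}n (leqnn n) p => m.
elim: m n => [|m IHm] n nm p Dp.
  move: nm; rewrite leqn0 => /eqP ->; rewrite mulr0 /growth /= subrr.
  rewrite sub0r oppr_le0 mulr_ge0// addr_ge0//.
  exact: le_trans (normr_ge0 _) (growth1_le Dp).
have B0 : 0 <= B by exact: le_trans (normr_ge0 _) (growth1_le Dp).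
have [k [k0 kN lk]] := ret p Dp.
have [kn|nk] := leqP k n.
  have -> : growth n p = growth k p + growth (n - k) (iter k T p).
    by rewrite -growthD subnK.
  have nkm : (n - k <= m)%N by rewrite leq_subLR (leq_trans nm)// -add1n leq_add2r.
  have := IHm (n - k)%N nkm _ (iter_stable k Dp).
  rewrite natrB//; move: lk; lra.
have nN : n%:R <= N%:R :> R by rewrite ler_nat (leq_trans (ltnW nk)).
have := growth_le n Dp; rewrite ler_norml => /andP[+ _].
have : l * n%:R <= `|l| * n%:R by rewrite ler_wpM2r// ler_norm.
have : (B + `|l|) * n%:R <= (B + `|l|) * N%:R by rewrite ler_wpM2l// addr_ge0.
lra.
Qed.

(** In the application this is a compactness property: the inequalities on the
    left are open conditions on [p]. *)
Hypothesis uniform_returns : forall m : R,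
  (forall p, D p -> exists2 k, (0 < k)%N & m * k%:R < growth k p) ->
  exists (N : nat) (e : R), 0 < e /\ forall p, D p ->
    exists k, [/\ (0 < k)%N, (k <= N)%N & (m + e) * k%:R <= growth k p].

(** The supremum [m] of the uniform lower rates is a limit of averages along one
    orbit. A point whose growth never exceeds [m * k] must exist, since
    otherwise the uniform returns would give a rate larger than [m]; at this
    point the lower bounds by rates [l < m] squeeze the averages to [m]. *)
Lemma minimal_growth_rate_attained : D !=set0 ->
  exists (p : X) (m : R), [/\ D p,
    (fun n => n%:R^-1 * growth n p) @ \oo --> m &
    forall l, l < m -> uniform_lower_rates l].
Proof.
move=> [p0 Dp0].
have rates_sup : has_sup uniform_lower_rates.
  split.
    exists (- B), 0 => p n Dp; rewrite subr0 mulNr.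
    by have := growth_le n Dp; rewrite ler_norml => /andP[].
  (* A rate [l > B] would give [(l - B) * n <= C] for all [n]. *)
  exists B => l [C Cl]; rewrite leNgt; apply/negP => Bl.
  have lB0 : 0 < l - B by rewrite subr_gt0.
  have := archi_boundP (divr_ge0 (normr_ge0 C) (ltW lB0)).
  set n := Num.bound _; rewrite ltr_pdivrMr// => Cn.
  have := Cl p0 n Dp0; have := growth_le n Dp0; rewrite ler_norml => /andP[_].
  have := ler_norm C; lra.
set m := sup uniform_lower_rates.
have rates_lt l : l < m -> uniform_lower_rates l.
  move=> /(sup_gt (proj1 rates_sup))[l' [C Cl'] ll'].
  exists C => p n Dp; apply: le_trans (Cl' p n Dp).
  by rewrite lerD2r ler_wpM2r// ltW.
have [p [Dp pm]] : exists p, D p /\ forall k, (0 < k)%N -> growth k p <= m * k%:R.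
  apply: contrapT => np; have [p Dp|N [e [e0 ret]]] := @uniform_returns m.
    apply: contrapT => nk; apply: np; exists p; split=> // k k0.
    by rewrite leNgt; apply/negP => mk; apply: nk; exists k.
  have /(sup_upper_bound rates_sup) : uniform_lower_rates (m + e).
    exact: uniform_lower_rate_of_returns ret.
  by rewrite -/m; lra.
exists p, m; split=> //; apply/cvgrPdist_le => e e0.
have [C Cm] := rates_lt (m - e / 2) ltac:(by rewrite ltrBlDr ltrDl divr_gt0).
near=> n.
have n0 : (0 < n)%N by near: n; exact: nbhs_infty_gt.
have n0R : 0 < n%:R :> R by rewrite ltr0n.
have Cn : C <= e / 2 * n%:R.
  rewrite mulrC -ler_pdivrMr ?divr_gt0//; near: n; exact: nbhs_infty_ger.
rewrite ler_norml; apply/andP; split.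
  rewrite lerBrDr addrC -lerBrDr opprK ler_pdivrMl// mulrC.
  apply: le_trans (pm n n0) _; rewrite ler_wpM2r//; lra.
rewrite lerBlDr -lerBlDl ler_pdivlMl// mulrC.
apply: le_trans _ (Cm p n Dp); lra.
Unshelve. all: by end_near. Qed.

End MinimalGrowth.

(** * Differentials *)

(** Compositions of chart expressions agree with the chart expression of the
    composition only near the point, because [fwd] and [bwd] are mutually
    inverse on the chart domain alone; this lemma bridges the gap. *)
Lemma near_eq_differential (R : realType) (V W : normedModType R)
    (h k : V -> W) (x : V) :
  {near x, h =1 k} -> differentiable h x ->
  differentiable k x /\ 'd k x = 'd h x :> (V -> W).
Proof.
move=> hk dh.
have kE : k \o shift x = cst (k x) + 'd h x +o_ 0 id.
  apply/eqaddoP => e e0.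
  have /eqaddoP/(_ e e0) := diff_locally dh.
  have hk0 : \forall y \near 0, h (y + x) = k (y + x).
    move: hk; rewrite (near_shift 0 x); apply: filterS => y /=.
    by rewrite subr0.
  apply: filter_app; apply: filterS hk0 => y hky.
  by rewrite /= !fctE /= hky (nbhs_singleton hk).
have dkE := diff_unique (diff_continuous dh) kE.
split=> //; apply/diff_locallyP; rewrite dkE; split=> //.
exact: diff_continuous.
Qed.

Lemma linear_row_sum (R : realType) (n : nat) (V : lmodType R)
    (l : {linear 'rV[R]_n -> V}) (u : 'rV[R]_n) :
  \sum_i u 0 i *: l (delta_mx 0 i) = l u.
Proof.
rewrite [in RHS](row_sum_delta u) linear_sum.
by apply: eq_bigr => i _; rewrite linearZ.
Qed.

(** Being of class C^1 is expressed by directional derivatives; expanding the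
    vector on the standard basis turns this into continuity of the differential
    jointly in the point and in the vector. *)
Lemma cvg_differential (R : realType) (n : nat) (W : normedModType R)
    (h : 'rV[R]_n -> W) (y0 u0 : 'rV[R]_n) (I : Type) (F : set_system I)
    {FF : Filter F} (y u : I -> 'rV[R]_n) :
  (\forall z \near y0, differentiable h z) ->
  (forall v, {for y0, continuous ('D_v h)}) ->
  y @ F --> y0 -> u @ F --> u0 ->
  (fun i => 'd h (y i) (u i)) @ F --> 'd h y0 u0.
Proof.
move=> dh ch yF uF.
have dE z v : differentiable h z ->
    'd h z v = \sum_(j < n) v 0 j *: 'D_(delta_mx 0 j) h z.
  move=> dz; apply: etrans (esym (linear_row_sum _ _)) _.
  by apply: eq_bigr => j _; rewrite deriveE.
have dh0 : differentiable h y0 by move: (nbhs_singleton dh).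
pose D (z v : 'rV[R]_n) := \sum_(j < n) v 0 j *: 'D_(delta_mx 0 j) h z.
have DF : (fun i => D (y i) (u i)) @ F --> D y0 u0.
  apply: (@cvg_big _ _ +%R) => [|j _]; first exact: add_continuous.
  apply: cvgZ; last exact: (cvg_comp _ _ yF (ch _)).
  exact: (cvg_comp _ _ uF (@coord_continuous _ _ _ _ _ u0)).
have dhF : \forall i \near F, differentiable h (y i) by exact: (yF _ dh).
apply: (eq_ind_r (fun l => (fun i => 'd h (y i) (u i)) @ F --> l) _ (dE _ _ dh0)).
by apply: cvg_trans DF; apply: near_eq_cvg; apply: filterS dhF => i /dE.
Qed.

(** * Differentials read in charts *)

Section ChartDifferential.
Context {R : realType} {d : nat} {M : manifold R d}.
Implicit Types (c : chart R M d) (x : M) (h : M -> M).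

(** The linear map of which [to_chart], [of_chart] and [tangent_map] are all
    instances, by taking [id] for [h] or preferred charts for [c] and [c']. The
    rules for changes of coordinates thus reduce to the chain rule below. *)
Definition chart_diff c c' h x : {linear 'rV[R]_d -> 'rV[R]_d} :=
  'd (fwd c' \o h \o bwd c) (fwd c x).

(** Asked in all charts at once, so that it is stable under composition without
    changing charts. *)
Definition manifold_differentiable h x : Prop :=
  {for x, continuous h} /\
  forall c c', atlas c -> atlas c' -> dom c x -> dom c' (h x) ->
    differentiable (fwd c' \o h \o bwd c) (fwd c x).

Lemma nbhs_dom c x : dom c x -> \forall y \near x, dom c y.
Proof. by move=> cx; apply: open_nbhs_nbhs; split=> //; exact: open_dom. Qed.

Lemma near_fwd c x (P : M -> Prop) : dom c x ->
  (\forall y \near x, P y) -> \forall z \near fwd c x, P (bwd c z).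
Proof.
move=> cx Px; have cz : (fwd c @` dom c) (fwd c x) by exists x.
have bx : bwd c @ fwd c x --> x.
  by rewrite -[x in _ --> x](fwdK cx); exact: bwd_continuous cz.
exact: (bx _ Px).
Qed.

(** The identity read in two charts is their transition map. *)
Lemma C1_map_id : C1_map (@id M).
Proof.
split; first by move=> x; exact: cvg_id.
by move=> c c' ca ca'; exact: (smooth_transition ca ca' 1).
Qed.

Lemma C1_map_differentiable h x : C1_map h -> manifold_differentiable h x.
Proof.
move=> [ch dh]; split=> [|c c' ca ca' cx c'x]; first exact: ch.
by apply: (proj1 (dh _ _ ca ca')); split; [exists x|rewrite fwdK].
Qed.

(** Near [h1 x] the intermediate [bwd c'] and [fwd c'] cancel, which reduces the
    claim to the chain rule in coordinate spaces. *)
Lemma chart_diff_comp c c' c'' h1 h2 x :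
  atlas c -> atlas c' -> atlas c'' ->
  dom c x -> dom c' (h1 x) -> dom c'' (h2 (h1 x)) ->
  manifold_differentiable h1 x -> manifold_differentiable h2 (h1 x) ->
  differentiable (fwd c'' \o (h2 \o h1) \o bwd c) (fwd c x) /\
  forall v, chart_diff c c'' (h2 \o h1) x v =
            chart_diff c' c'' h2 (h1 x) (chart_diff c c' h1 x v).
Proof.
move=> ca ca' ca'' cx c'x c''x [ch1 dh1] [ch2 dh2].
have d1 := dh1 _ _ ca ca' cx c'x; have d2 := dh2 _ _ ca' ca'' c'x c''x.
set F1 := fwd c' \o h1 \o bwd c in d1.
set F2 := fwd c'' \o h2 \o bwd c' in d2.
have F1x : F1 (fwd c x) = fwd c' (h1 x) by rewrite /F1 /= fwdK.
rewrite -F1x in d2.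
have E : {near fwd c x, F2 \o F1 =1 fwd c'' \o (h2 \o h1) \o bwd c}.
  have c'h1 : \forall y \near x, dom c' (h1 y) by exact: (ch1 _ (nbhs_dom c'x)).
  have K : \forall y \near x, bwd c' (fwd c' (h1 y)) = h1 y.
    by apply: filterS c'h1 => y; exact: fwdK.
  by apply: filterS (near_fwd cx K) => z /= Kz; rewrite /F1 /F2 /= Kz.
have [dF dFE] := near_eq_differential E (differentiable_comp d1 d2).
split=> [|v]; first exact: dF.
apply: etrans (congr1 (@^~ v) dFE) _.
apply: etrans (congr1 (@^~ v) (diff_comp d1 d2)) _.
suff d2E z : z = fwd c' (h1 x) ->
    'd F2 z ('d F1 (fwd c x) v) = 'd F2 (fwd c' (h1 x)) ('d F1 (fwd c x) v).
  exact: d2E F1x.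
by move=> ->.
Qed.

Lemma manifold_differentiable_comp h1 h2 x :
  manifold_differentiable h1 x -> manifold_differentiable h2 (h1 x) ->
  manifold_differentiable (h2 \o h1) x.
Proof.
move=> d1 d2; split; first exact: continuous_comp (proj1 d1) (proj1 d2).
move=> c c'' ca ca'' cx c''x.
have [dh _] := chart_diff_comp (h1 := h1) (h2 := h2) ca
  (chart_at_atlas (h1 x)) ca'' cx (dom_chart_at _) c''x d1 d2.
exact: dh.
Qed.

Lemma manifold_differentiable_id x : manifold_differentiable id x.
Proof. exact/C1_map_differentiable/C1_map_id. Qed.

Lemma chart_diff_id c x v : dom c x -> chart_diff c c id x v = v.
Proof.
move=> cx; have E : {near fwd c x, id =1 fwd c \o id \o bwd c}.
  have : nbhs (fwd c x) (fwd c @` dom c).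
    by apply: open_nbhs_nbhs; split; [exact: open_cod|exists x].
  by apply: filterS => _ [y cy <-] /=; rewrite fwdK.
have idD := is_diff_id (fwd c x).
have [_ dE] := near_eq_differential E (@ex_diff _ _ _ _ _ _ _ idD).
by apply: etrans (congr1 (@^~ v) dE) _; rewrite (@diff_val _ _ _ _ _ _ _ idD).
Qed.

End ChartDifferential.

(** * The tangent bundle as a space *)

Lemma cvg_to_pair (I : Type) (U V : topologicalType) (F : set_system I)
    {FF : Filter F} (h : I -> U * V) (l : U * V) :
  (fun i => (h i).1) @ F --> l.1 -> (fun i => (h i).2) @ F --> l.2 ->
  h @ F --> l.
Proof.
case: l => a b ha hb; have -> : h = (fun i => ((h i).1, (h i).2)).
  by apply/funext => i; case: (h i).
exact: (cvg_pair ha hb).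
Qed.

Section TangentBundle.
Context {R : realType} {d : nat} {M : manifold R d}.
Implicit Types (c : chart R M d) (h : M -> M) (p : M * 'rV[R]_d).

Definition tangent_lift h p : M * 'rV[R]_d :=
  (h p.1, @tangent_map R d M h p.1 p.2).

(** Chain rule. Through it the growth along orbits of the lift, which is a
    cocycle, is the growth that Lyapunov exponents measure. *)
Lemma iter_tangent_lift h n p : C1_map h ->
  iter n (tangent_lift h) p = tangent_lift (iter n h) p.
Proof.
move=> h_C1; case: p => x v.
have dh k y : manifold_differentiable (iter k h) y.
  elim: k y => [|k IHk] y; first exact: manifold_differentiable_id.
  by apply: manifold_differentiable_comp => //; exact: C1_map_differentiable.
elim: n => [|n IHn].
  rewrite /tangent_lift /=; congr pair.
  by rewrite [RHS](chart_diff_id v (dom_chart_at x)).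
rewrite /= IHn /tangent_lift /=; congr pair; symmetry.
apply: (proj2 (chart_diff_comp (h1 := iter n h) (h2 := h) _ _ _ _ _ _ _ _)).
- exact: chart_at_atlas.
- exact: chart_at_atlas.
- exact: chart_at_atlas.
- exact: dom_chart_at.
- exact: dom_chart_at.
- exact: dom_chart_at.
- exact: dh.
- exact: (dh 1).
Qed.

Definition trivialize (x0 : M) p : M * 'rV[R]_d :=
  (p.1, @to_chart R d M (chart_at x0) p.1 p.2).

(** Neighbourhoods in the tangent bundle, in the local trivialization given by
    the chart at the base point of [p0]. Products of neighbourhoods in
    [M * 'rV_d] would be wrong, since the coordinates of a tangent vector at [x]
    refer to [chart_at x], which need not depend continuously on [x]. *)
Definition tangent_nbhs p0 : set_system (M * 'rV[R]_d) :=
  filter_from (nbhs p0) (preimage (trivialize p0.1)).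

Global Instance tangent_nbhs_filter p0 : Filter (tangent_nbhs p0).
Proof.
apply: filter_from_filter; first by exists setT; exact: filterT.
by move=> A B pA pB; exists (A `&` B); [exact: filterI|].
Qed.

Lemma cvg_tangent_nbhsP (I : Type) (F : set_system I) {FF : Filter F}
    (xi : I -> M * 'rV[R]_d) p0 :
  (trivialize p0.1 \o xi) @ F --> p0 -> xi @ F `=>` tangent_nbhs p0.
Proof.
move=> xiF A [B pB BA].
have FB : \forall i \near F, B (trivialize p0.1 (xi i)) by exact: (xiF _ pB).
by apply: filterS FB => i; exact: BA.
Qed.

Lemma trivialize_cvg p0 : trivialize p0.1 @ tangent_nbhs p0 --> p0.
Proof. by move=> B pB; exists B. Qed.

Lemma base_cvg p0 : fst @ tangent_nbhs p0 --> p0.1.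
Proof. exact: (cvg_comp _ _ (@trivialize_cvg p0) cvg_fst). Qed.

Lemma coordinates_cvg p0 :
  (fun p => (trivialize p0.1 p).2) @ tangent_nbhs p0 --> p0.2.
Proof. exact: (cvg_comp _ _ (@trivialize_cvg p0) cvg_snd). Qed.

Lemma fwd_base_cvg p0 :
  (fun p => fwd (chart_at p0.1) p.1) @ tangent_nbhs p0
    --> fwd (chart_at p0.1) p0.1.
Proof. exact: (cvg_comp _ _ (@base_cvg p0) (fwd_continuous (dom_chart_at _))). Qed.

(** In the trivializations at [x0] and [h x0], the lift reads as the differential
    of the C^1 expression of [h] in the two fixed charts, which is jointly
    continuous. *)
Lemma tangent_lift_cvg h p0 : C1_map h ->
  tangent_lift h @ tangent_nbhs p0 `=>` tangent_nbhs (tangent_lift h p0).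
Proof.
move=> h_C1; case: p0 => x0 v0; apply: cvg_tangent_nbhsP.
set c0 := chart_at x0; set c1 := chart_at (h x0).
have ac0 := chart_at_atlas x0; have ac1 := chart_at_atlas (h x0).
have c0x := dom_chart_at x0; have c1x := dom_chart_at (h x0).
have hx0 := proj1 h_C1 x0.
have c0c1 : \forall x \near x0, dom c0 x /\ dom c1 (h x).
  apply: filterI; first exact: nbhs_dom c0x.
  exact: hx0 _ (nbhs_dom c1x).
apply: cvg_to_pair; first exact: (cvg_comp _ _ (@base_cvg (x0, v0)) hx0).
have [dh ch] := proj2 h_C1 _ _ ac0 ac1.
have dh0 : \forall z \near fwd c0 x0, differentiable (fwd c1 \o h \o bwd c0) z.
  have cz : nbhs (fwd c0 x0) (cod c0).
    by apply: open_nbhs_nbhs; split; [exact: open_cod|exists x0].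
  have zc := near_fwd c0x c0c1.
  by apply: filterS2 cz zc => z cz [_ c1z]; exact: dh.
have chv v : {for fwd c0 x0, continuous ('D_v (fwd c1 \o h \o bwd c0))}.
  by apply: ch; split; [exists x0|rewrite fwdK].
have readF : (fun p => chart_diff c0 c1 h p.1 (trivialize x0 p).2)
    @ tangent_nbhs (x0, v0) --> chart_diff c0 c1 h x0 v0.
  exact: (cvg_differential dh0 chv (@fwd_base_cvg (x0, v0))
    (@coordinates_cvg (x0, v0))).
suff E : {near tangent_nbhs (x0, v0),
    (fun p => chart_diff c0 c1 h p.1 (trivialize x0 p).2) =1
    (fun p => (trivialize (h x0) (tangent_lift h p)).2)}.
  exact: (cvg_trans (near_eq_cvg E) readF).
have c0c1F : \forall p \near tangent_nbhs (x0, v0), dom c0 p.1 /\ dom c1 (h p.1).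
  exact: (@base_cvg (x0, v0) _ c0c1).
apply: filterS c0c1F => -[x v] /= [c0z c1z].
have ax := chart_at_atlas x; have cx := dom_chart_at x.
have dx := C1_map_differentiable x h_C1.
(* The differential of [h] from [chart_at x] to [c1] is factored in two ways:
   through [c0] at [x], and through [chart_at (h x)] at [h x]. *)
have Elhs := proj2 (chart_diff_comp (h1 := id) (h2 := h) ax ac0 ac1 cx c0z c1z
  (manifold_differentiable_id x) dx) v.
have Erhs := proj2 (chart_diff_comp (h1 := h) (h2 := id) ax (chart_at_atlas (h x))
  ac1 cx (dom_chart_at (h x)) c1z dx (manifold_differentiable_id _)) v.
exact (etrans (esym Elhs) Erhs).
Qed.

Variable g : riemannian_metric M.

Lemma inner_sum_l (x : M) (I : Type) (r : seq I) (a : I -> R)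
    (e : I -> tangent x) (w : tangent x) :
  g x (\sum_(i <- r) a i *: e i) w = \sum_(i <- r) a i * g x (e i) w.
Proof.
elim: r => [|i r IHr]; last by rewrite !big_cons inner_linear IHr.
have := inner_linear g 1 (0 : tangent x) 0 w.
rewrite !big_nil scaler0 addr0 mul1r => /eqP.
by rewrite addrC -subr_eq subrr eq_sym => /eqP.
Qed.

Lemma inner_sum (x : M) (u : 'rV[R]_d) (e : 'I_d -> tangent x) :
  g x (\sum_i u 0 i *: e i) (\sum_i u 0 i *: e i) =
  \sum_i u 0 i * \sum_j u 0 j * g x (e j) (e i).
Proof.
rewrite inner_sum_l; apply: eq_bigr => i _.
by rewrite inner_sym inner_sum_l.
Qed.

(** In the trivialization at the base point the metric is a quadratic form whose
    coefficients are continuous functions of the point. *)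
Lemma riemannian_norm_cvg p0 :
  (fun p => @riemannian_norm R d M g p.1 p.2) @ tangent_nbhs p0
    --> @riemannian_norm R d M g p0.1 p0.2.
Proof.
rewrite /riemannian_norm.
apply: (cvg_comp (fun p => g p.1 p.2 p.2) Num.sqrt); last exact: sqrt_continuous.
case: p0 => x0 v0 /=; set c0 := chart_at x0.
have ac0 := chart_at_atlas x0; have c0x := dom_chart_at x0.
pose G i j y := g (bwd c0 y) (of_chart c0 (bwd c0 y) (delta_mx 0 i))
                             (of_chart c0 (bwd c0 y) (delta_mx 0 j)).
pose N (u : 'rV[R]_d) y := \sum_i u 0 i * \sum_j u 0 j * G j i y.
(* [N u y] is the squared norm of the vector with coordinates [u] in [c0]. *)
have gE x v : dom c0 x ->
    g x v v = N (@to_chart R d M c0 x v) (fwd c0 x).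
  move=> c0z; rewrite /N /G fwdK// -inner_sum.
  suff -> : \sum_i @to_chart R d M c0 x v 0 i *:
      @of_chart R d M c0 x (delta_mx 0 i) = v by [].
  have ax := chart_at_atlas x; have cx := dom_chart_at x.
  have vE := proj2 (chart_diff_comp (h1 := id) (h2 := id) ax ac0 ax cx c0z cx
    (manifold_differentiable_id x) (manifold_differentiable_id x)) v.
  apply: etrans (linear_row_sum (chart_diff c0 (chart_at x) id x)
    (chart_diff (chart_at x) c0 id x v)) _.
  exact (etrans (esym vE) (chart_diff_id v cx)).
rewrite gE// (chart_diff_id v0 c0x : to_chart c0 v0 = v0).
have : (fun p => N (trivialize x0 p).2 (fwd c0 p.1)) @ tangent_nbhs (x0, v0)
    --> N v0 (fwd c0 x0).
  have uF i : (fun p => (trivialize x0 p).2 0 i) @ tangent_nbhs (x0, v0)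
      --> v0 0 i.
    exact: (cvg_comp _ _ (@coordinates_cvg (x0, v0)) (@coord_continuous _ _ _ _ _ v0)).
  apply: (@cvg_big _ _ +%R) => [|i _]; first exact: add_continuous.
  apply: cvgM; first exact: uF.
  apply: (@cvg_big _ _ +%R) => [|j _]; first exact: add_continuous.
  apply: cvgM; first exact: uF.
  apply: (cvg_comp _ _ (@fwd_base_cvg (x0, v0))).
  by apply: (inner_smooth g ac0 _ _ 0%N); exists x0.
apply: cvg_trans; apply: near_eq_cvg.
have c0F : \forall p \near tangent_nbhs (x0, v0), dom c0 p.1.
  exact: (@base_cvg (x0, v0) _ (nbhs_dom c0x)).
by apply: filterS c0F => -[x v] /= /gE.
Qed.

Lemma riemannian_norm_gt0 (x : M) (v : tangent x) :
  v != 0 -> 0 < riemannian_norm g v.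
Proof. by move=> v0; rewrite sqrtr_gt0 inner_gt0. Qed.

Lemma riemannian_normZ (x : M) (a : R) (v : tangent x) :
  @riemannian_norm R d M g x (a *: v) = `|a| * riemannian_norm g v.
Proof.
have gZl b (u w : tangent x) : @inner _ _ _ g x (b *: u) w = b * g x u w.
  have := inner_sum_l [:: tt] (fun=> b) (fun=> u) w.
  by rewrite !big_seq1.
rewrite /riemannian_norm gZl inner_sym gZl mulrA -expr2 sqrtrM ?sqr_ge0//.
by rewrite sqrtr_sqr.
Qed.

Definition log_norm p : R := ln (@riemannian_norm R d M g p.1 p.2).

Lemma log_norm_cvg p0 : p0.2 != 0 ->
  log_norm @ tangent_nbhs p0 --> log_norm p0.
Proof.
move=> p00; apply: (cvg_comp _ _ (@riemannian_norm_cvg p0)).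
exact/continuous_ln/riemannian_norm_gt0.
Qed.

Lemma growth_cvg h n p0 : C1_map h ->
  p0.2 != 0 -> (iter n (tangent_lift h) p0).2 != 0 ->
  growth (tangent_lift h) log_norm n @ tangent_nbhs p0
    --> growth (tangent_lift h) log_norm n p0.
Proof.
move=> h_C1 p00 hp00; apply: cvgB; last exact: log_norm_cvg.
apply: cvg_comp (log_norm_cvg hp00).
elim: n {hp00} => [|n IHn]; first exact: cvg_id.
exact: cvg_comp IHn (tangent_lift_cvg h_C1).
Qed.

Lemma growthZ h n (x : M) (v : 'rV[R]_d) (a : R) : C1_map h ->
  a != 0 -> v != 0 -> (iter n (tangent_lift h) (x, v)).2 != 0 ->
  growth (tangent_lift h) log_norm n (x, a *: v) =
  growth (tangent_lift h) log_norm n (x, v).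
Proof.
move=> h_C1 a0 v0; rewrite /growth !iter_tangent_lift//= /log_norm /= => hv0.
have -> : @tangent_map R d M (iter n h) x (a *: v) =
    a *: @tangent_map R d M (iter n h) x v by exact: linearZ.
rewrite !riemannian_normZ.
rewrite !lnM ?posrE ?normr_gt0 ?riemannian_norm_gt0//.
by rewrite opprD addrACA subrr add0r.
Qed.

End TangentBundle.

(** * Compactness of the unit sphere bundle *)

Lemma compact_unit_sphere (R : realType) (n : nat) :
  compact [set c : 'rV[R]_n | `|c| = 1].
Proof.
apply: bounded_closed_compact.
  by exists 1; split=> // r r1 c /= ->; exact: ltW.
apply: (@preimage_closed _ _ (fun c : 'rV[R]_n => `|c|) [set 1]); last exact: closed_eq.
by move=> c _; exact: norm_continuous.
Qed.

Section SphereBundle.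
Context {R : realType} {d : nat} {M : manifold R d}.
Variables (L : set M) (E : forall x : M, {vspace tangent x}).

Definition nonzero_vectors : set (M * 'rV[R]_d) :=
  [set p | [/\ L p.1, p.2 \in E p.1 & p.2 != 0]].

(** Coordinates on the subbundle: with a local frame [e], the vectors over points
    near [x0] are parametrized by the product of a coordinate space and [M]. *)
Definition frame_sum (k : nat) (e : 'I_k -> forall x : M, tangent x)
    (c : 'rV[R]_k) (x : M) : M * 'rV[R]_d :=
  (x, \sum_j c 0 j *: (e j x : 'rV[R]_d)).

Lemma frame_sum_nonzero (k : nat) (e : 'I_k -> forall x : M, tangent x) x c :
  L x -> basis_of (E x) [seq e j x | j : 'I_k] -> c != 0 ->
  nonzero_vectors (frame_sum e c x).
Proof.
move=> Lx bX c0.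
have bX' : basis_of (E x) [tuple e j x | j < k] by exact: bX.
have nthX (j : 'I_k) : [tuple e j x | j < k]`_j = e j x.
  by rewrite -tnth_nth tnth_mktuple.
split=> //=.
  apply: rpred_sum => j _; apply: rpredZ.
  by rewrite -(nthX j); apply: (basis_mem bX'); rewrite mem_nth// size_tuple.
apply: contraNneq c0 => s0; apply/eqP/rowP => j; rewrite mxE.
have /freeP freeX := basis_free bX'.
apply: (freeX (c 0)); rewrite -[RHS]s0.
by apply: eq_bigr => i _; rewrite nthX.
Qed.

Lemma frame_sum_surj (k : nat) (e : 'I_k -> forall x : M, tangent x) x
    (v : 'rV[R]_d) :
  basis_of (E x) [seq e j x | j : 'I_k] -> v \in E x ->
  exists c, (x, v) = frame_sum e c x.
Proof.
move=> bX vE; have bX' : basis_of (E x) [tuple e j x | j < k] by exact: bX.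
exists (\row_j coord [tuple e j x | j < k] j v); congr pair.
rewrite [LHS](coord_basis bX' vE); apply: eq_bigr => j _.
by rewrite mxE -tnth_nth tnth_mktuple.
Qed.

Lemma frame_sumZ (k : nat) (e : 'I_k -> forall x : M, tangent x) c x a :
  frame_sum e (a *: c) x = (x, a *: (frame_sum e c x).2).
Proof.
congr pair; rewrite scaler_sumr; apply: eq_bigr => j _.
by rewrite mxE scalerA.
Qed.

(** The parametrization by a continuous frame is continuous for [tangent_nbhs].
    Points are confined to [A] since frames are continuous on [L] only. *)
Lemma frame_sum_cvg (k : nat) (e : 'I_k -> forall x : M, tangent x)
    (A : set M) (x0 : M) (c0 : 'rV[R]_k) :
  A x0 ->
  (forall j, {within A, continuous
     (fun x => @to_chart R d M (chart_at x0) x (e j x))}) ->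
  (fun q => frame_sum e q.1 q.2) @ filter_prod (nbhs c0) (within A (nbhs x0))
    `=>` tangent_nbhs (frame_sum e c0 x0).
Proof.
move=> Ax0 econt; apply: cvg_tangent_nbhsP; apply: cvg_to_pair => /=.
  exact: cvg_comp cvg_snd (cvg_within _).
pose u (q : 'rV[R]_k * M) :=
  \sum_j q.1 0 j *: @to_chart R d M (chart_at x0) q.2 (e j q.2).
have uE (c : 'rV[R]_k) x :
    u (c, x) = (trivialize x0 (frame_sum e c x)).2.
  rewrite /trivialize /to_chart /= linear_sum.
  by apply: eq_bigr => j _; rewrite linearZ.
have -> : (fun q => (trivialize x0 (frame_sum e q.1 q.2)).2) = u.
  by apply/funext => -[c x]; rewrite uE.
have -> : \sum_j c0 0 j *: (e j x0 : 'rV[R]_d) = u (c0, x0).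
  rewrite uE; symmetry; exact: (chart_diff_id _ (dom_chart_at x0)).
rewrite /u /=; apply: (@cvg_big 'rV[R]_d _ +%R) => [|j _]; first exact: add_continuous.
have c0F : (fun q : 'rV[R]_k * M => q.1 0 j)
    @ filter_prod (nbhs c0) (within A (nbhs x0)) --> c0 0 j.
  apply: (@cvg_comp _ _ _ fst (fun c : 'rV[R]_k => c 0 j) _ (nbhs c0)).
    exact: cvg_fst.
  exact: coord_continuous.
have /subspace_continuousP/(_ x0 Ax0) ejF := econt j.
exact: (@cvgZ R 'rV[R]_d _ _ _ _ _ _ _ c0F (cvg_comp _ _ cvg_snd ejF)).
Qed.

(** Compactness of the projectivized subbundle, for properties [P n] that grow
    with [n]: if each vector has a neighbourhood and an [n] for which [P n]
    holds there, some [n] works everywhere. Near a point of [L], the nonzero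
    vectors are the multiples of combinations of a frame with coefficients on
    the unit sphere, so the compactness of this sphere and then that of [L]
    apply. *)
Lemma uniform_on_nonzero_vectors (P : nat -> M * 'rV[R]_d -> Prop) :
  compact L -> continuous_subbundle L E ->
  (forall n m p, (n <= m)%N -> P n p -> P m p) ->
  (forall n x v a, nonzero_vectors (x, v) -> a != 0 ->
     P n (x, v) -> P n (x, a *: v)) ->
  (forall p0, nonzero_vectors p0 ->
     exists n, \forall p \near tangent_nbhs p0, nonzero_vectors p -> P n p) ->
  exists n, forall p, nonzero_vectors p -> P n p.
Proof.
move=> Lcpt Econt Pmono Pscale Ploc.
suff /filter_ex[n nP] : \forall n \near \oo, L `<=`
    (fun x => forall v, nonzero_vectors (x, v) -> P n (x, v)).
  by exists n => -[x v] Dp; apply: (nP x _ v Dp); case: Dp.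
move/compact_near_coveringP/near_covering_withinP : Lcpt; apply => x0 Lx0.
have [U [k [e [[Uo Ux0] _ ebasis econt]]]] := Econt x0 Lx0.
(* First the whole fibre at [x0] together with its neighbours, by compactness of
   the sphere of coefficients. *)
have SC : \forall i \near filter_prod (within (L `&` U) (nbhs x0)) \oo,
    [set c : 'rV[R]_k | `|c| = 1] `<=` (fun c => P i.2 (frame_sum e c i.1)).
  have := @compact_unit_sphere R k.
  move/compact_near_coveringP/near_covering_withinP; apply => c0 /= c01.
  have c_neq0 (c : 'rV[R]_k) : `|c| = 1 -> c != 0.
    by move=> c1; rewrite -normr_eq0 c1 oner_neq0.
  have Dp0 := frame_sum_nonzero Lx0 (ebasis _ Lx0 Ux0) (c_neq0 _ c01).
  have [n Pn] := Ploc _ Dp0.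
  have : \forall q \near filter_prod (nbhs c0) (within (L `&` U) (nbhs x0)),
      nonzero_vectors (frame_sum e q.1 q.2) -> P n (frame_sum e q.1 q.2).
    exact: (frame_sum_cvg (c0 := c0) (conj Lx0 Ux0) econt Pn).
  move=> [[B1 B2] /= [c0B1 x0B2] BP].
  exists (B1, (B2 `&` (L `&` U)) `*` [set m | (n <= m)%N]) => /=.
    split=> //; exists (B2 `&` (L `&` U), [set m | (n <= m)%N]) => //=.
    split; last exact: nbhs_infty_ge.
    by apply: filterI => //; exact: withinT.
  move=> [c [x m]] /= [B1c [[B2x [Lx Ux]] nm]] c1.
  apply: (Pmono _ _ _ nm); apply: (BP (c, x)) => //=.
  exact: frame_sum_nonzero (ebasis _ Lx Ux) (c_neq0 _ c1).
case: SC => -[A N] /= [x0A ooN] AN.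
exists ([set x | (L `&` U) x -> A x] `&` U, N) => /=.
  split=> //; apply: filterI => //; exact: open_nbhs_nbhs.
move=> [x n] /= [[Ax Ux] Nn] Lx v [/= _ vE v0].
have bx := ebasis _ Lx Ux.
have [c xvE] := frame_sum_surj bx vE.
have c0 : c != 0.
  apply: contraNneq v0 => c0; move: xvE; rewrite c0 => -[->].
  by rewrite big1// => j _; rewrite mxE scale0r.
have nc0 : `|c| != 0 by rewrite normr_eq0.
have sc1 : `| `|c|^-1 *: c | = 1.
  by rewrite normrZ ger0_norm ?invr_ge0// mulVf.
rewrite xvE -[c](scalerKV nc0) frame_sumZ.
have scn0 : `|c|^-1 *: c != 0 by rewrite -normr_eq0 sc1 oner_neq0.
apply: Pscale => //; first exact: frame_sum_nonzero.
exact: (AN (x, n) (conj (Ax (conj Lx Ux)) Nn) _ sc1).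
Qed.

End SphereBundle.

(** * Expansion from positive Lyapunov exponents *)

Section Expansion.
Context {R : realType} {d : nat} {M : manifold R d}.
Variables (g : riemannian_metric M) (f : M -> M) (L : set M).
Variable E : forall x : M, {vspace tangent x}.
Hypothesis f_C1 : C1_map f.
Hypothesis L_compact : compact L.
Hypothesis L_invariant : f @` L `<=` L.
Hypothesis L_noncritical : forall x, L x -> ~ critical_point f x.
Hypothesis E_continuous : continuous_subbundle L E.
Hypothesis E_invariant : tangent_invariant f L E.

Let T := @tangent_lift R d M f.
Let D := nonzero_vectors L E.
Let tgrowth := growth T (log_norm g).

(** Without critical points on [L], nonzero vectors are never killed, so that
    the logarithms of norms make sense along whole orbits. *)
Lemma tangent_lift_nonzero p : D p -> D (T p).
Proof.
case: p => x v [/= Lx vE v0]; split=> /=.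
- by apply: L_invariant; exists x.
- exact: E_invariant.
have J_unit : jacobian (local_rep f x) (fwd (chart_at x) x) \in unitmx.
  by rewrite unitmxE unitfE; apply/eqP => /(L_noncritical Lx).
apply: contra_neq v0 => Tv0.
apply: (can_inj (mulmxK J_unit)); rewrite mul0mx /jacobian mul_rV_lin1.
exact: Tv0.
Qed.

Let tgrowth_cvg n p : D p -> tgrowth n @ tangent_nbhs p --> tgrowth n p.
Proof.
move=> Dp; apply: growth_cvg => //; first by case: Dp.
by case: (iter_stable tangent_lift_nonzero n Dp).
Qed.

Let tgrowthZ n x v a : D (x, v) -> a != 0 ->
  tgrowth n (x, a *: v) = tgrowth n (x, v).
Proof.
move=> Dp a0; apply: growthZ => //; first by case: Dp.
by case: (iter_stable tangent_lift_nonzero n Dp).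
Qed.

Lemma tangent_growth1_bounded : exists B, forall p, D p -> `|tgrowth 1 p| <= B.
Proof.
have [|||n nP] := @uniform_on_nonzero_vectors R d M L E
    (fun n p => `|tgrowth 1 p| <= n%:R) L_compact E_continuous; last by exists n%:R.
- by move=> n m p nm /le_trans; apply; rewrite ler_nat.
- by move=> n x v a Dp a0; rewrite tgrowthZ.
move=> p0 Dp0; exists (Num.bound `|tgrowth 1 p0|).
have lt_bound : `|tgrowth 1 p0| < (Num.bound `|tgrowth 1 p0|)%:R.
  exact/archi_boundP/normr_ge0.
have lt_near : \forall p \near tangent_nbhs p0,
    `|tgrowth 1 p| < (Num.bound `|tgrowth 1 p0|)%:R.
  exact: (cvgr_lt _ (cvg_norm (tgrowth_cvg (n := 1) Dp0)) _ lt_bound).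
by apply: filterS lt_near => p /ltW.
Qed.

(** The strict inequalities leave room for a small margin [1 / (n + 1)] near each
    vector, and larger [n] both shrinks the margin and allows longer returns, so
    that one [n] suffices everywhere. *)
Lemma tangent_uniform_returns (m : R) :
  (forall p, D p -> exists2 k, (0 < k)%N & m * k%:R < tgrowth k p) ->
  exists (N : nat) (e : R), 0 < e /\ forall p, D p ->
    exists k, [/\ (0 < k)%N, (k <= N)%N & (m + e) * k%:R <= tgrowth k p].
Proof.
move=> ret; pose P n p := exists k,
  [/\ (0 < k)%N, (k <= n)%N & (m + n.+1%:R^-1) * k%:R <= tgrowth k p].
suff [n nP] : exists n, forall p, D p -> P n p.
  by exists n, n.+1%:R^-1; split; [rewrite invr_gt0 ltr0n|].
apply: uniform_on_nonzero_vectors => //.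
- move=> n n' p nn' [k [k0 kn kP]]; exists k; split=> //; first exact: leq_trans nn'.
  apply: le_trans kP; rewrite ler_wpM2r// lerD2l lef_pV2 ?posrE ?ltr0n//.
  by rewrite ler_nat.
- by move=> n x v a Dp a0 [k kP]; exists k; rewrite tgrowthZ.
move=> p0 Dp0; have [k k0 mk] := ret p0 Dp0.
set gap := tgrowth k p0 - m * k%:R.
have gap0 : 0 < gap by rewrite subr_gt0.
(* [n] must exceed both the return time and [k / gap], which makes the margin
   [k / (n + 1)] smaller than [gap]. *)
pose n := (k + Num.bound (k%:R / gap))%N; exists n.
have lt_growth : (m + n.+1%:R^-1) * k%:R < tgrowth k p0.
  rewrite mulrDl -ltrBrDl -/gap mulrC ltr_pdivrMr ?ltr0n// mulrC -ltr_pdivrMr//.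
  apply: lt_le_trans (archi_boundP _) _; first by rewrite divr_ge0// ltW.
  by rewrite ler_nat /n -addnS -addSnnS leq_addl.
have gt_near : \forall p \near tangent_nbhs p0,
    (m + n.+1%:R^-1) * k%:R < tgrowth k p.
  exact: (cvgr_gt _ (tgrowth_cvg (n := k) Dp0) _ lt_growth).
apply: filterS gt_near => p /ltW kP _; exists k; split=> //; exact: leq_addr.
Qed.

Lemma tangent_map_iterE n p :
  iter n T p = (iter n f p.1, @tangent_map R d M (iter n f) p.1 p.2).
Proof. exact: iter_tangent_lift. Qed.

(** The growth differs from [ln |Df^n v|] by the constant [ln |v|], which
    vanishes in the average. *)
Lemma growth_rate_is_exponent p (m : R) : D p ->
  (fun n => n%:R^-1 * tgrowth n p) @ \oo --> m ->
  lyapunov_exponents g f L E m.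
Proof.
case: p => x v [Lx vE v0] grow; exists x, v; split=> //.
pose c := log_norm g (x, v).
have inv0 : (fun n : nat => n%:R^-1 * c : R) @ \oo --> (0 : R).
  rewrite -[X in _ --> X](mul0r c); apply: cvgM; last exact: cvg_cst.
  by rewrite -cvg_shiftS; exact: cvg_harmonic.
suff -> : (fun n : nat => n%:R^-1 *
    ln (@riemannian_norm R d M g (iter n f x) (@tangent_map R d M (iter n f) x v)))
    = (fun n => n%:R^-1 * tgrowth n (x, v) + n%:R^-1 * c).
  by rewrite -[m]addr0; exact: cvgD.
apply/funext => n.
by rewrite -mulrDr /tgrowth /growth subrK tangent_map_iterE.
Qed.

Lemma uniformly_expanding_of_rate (l : R) : 0 < l ->
  uniform_lower_rates T (log_norm g) D l -> uniformly_expanding g f L E.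
Proof.
move=> l0 [C Cl]; exists (expR (- C)), l; split=> //; first exact: expR_gt0.
move=> x v n Lx vE _; have [->|v0] := eqVneq v 0.
  have norm0 (y : M) : @riemannian_norm R d M g y 0 = 0.
    rewrite -[X in riemannian_norm _ X](scale0r (0 : 'rV[R]_d)).
    by rewrite riemannian_normZ normr0 mul0r.
  by rewrite norm0 mulr0 sqrtr_ge0.
have Dp : D (x, v) by [].
have /= [_ _] := iter_stable tangent_lift_nonzero n Dp.
have := Cl _ n Dp; rewrite /growth tangent_map_iterE /log_norm /= => Cn Tv0.
rewrite -expRD -[leRHS]lnK ?posrE ?riemannian_norm_gt0//.
rewrite -[X in _ * X <= _]lnK ?posrE ?riemannian_norm_gt0// -expRD ler_expR.
move: Cn; lra.
Qed.

End Expansion.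

Theorem theorem4 (R : realType) (d : nat) (d_ge1 : (1 <= d)%N)
    (M : manifold R d) (M_compact : compact [set: M])
    (g : riemannian_metric M)
    (f : M -> M) (f_C1 : C1_map f)
    (L : set M) (L_compact : compact L) (L_invariant : f @` L `<=` L)
    (L_noncritical : forall x, L x -> ~ critical_point f x)
    (E1 E2 : forall x : M, {vspace tangent x})
    (E_splitting : continuous_splitting L E1 E2)
    (E1_invariant : tangent_invariant f L E1)
    (E2_invariant : tangent_invariant f L E2)
    (exponents_gt0 : forall l : R, lyapunov_exponents g f L E1 l -> 0 < l) :
  uniformly_expanding g f L E1.
Proof.
have [E1_continuous _ _] := E_splitting.
have [D0|noD] := pselect (nonzero_vectors L E1 !=set0); last first.
  (* Without nonzero vectors every rate will do. *)
  apply: (@uniformly_expanding_of_rate _ _ _ g f L E1 _ _ _ _ 1) => //.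
  by exists 0 => p n Dp; case: noD; exists p.
have [B growth_le_B] := tangent_growth1_bounded g f_C1 L_compact
  L_invariant L_noncritical E1_continuous E1_invariant.
have [p [m [Dp p_rate lower_rates]]] := minimal_growth_rate_attained
  (tangent_lift_nonzero L_invariant L_noncritical E1_invariant) growth_le_B
  (tangent_uniform_returns f_C1 L_compact L_invariant L_noncritical
     E1_continuous E1_invariant) D0.
have m0 : 0 < m.
  exact/exponents_gt0/(growth_rate_is_exponent f_C1 Dp p_rate).
apply: (@uniformly_expanding_of_rate _ _ _ g f L E1 _ _ _ _ (m / 2)) => //.
  by rewrite divr_gt0.
by apply: lower_rates; rewrite ltr_pdivrMr// ltr_pMr// ltr1n.
Qed.
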